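(* Let $\widehat\Sigma\in\mathbb{R}^{n\times n}$ be symmetric strictly positive definite, partitioned as $\widehat\Sigma=\begin{pmatrix}\widehat\Sigma_{11}&\widehat\Sigma_{12}\\ \widehat\Sigma_{21}&\widehat\Sigma_{22}\end{pmatrix}$ with $\widehat\Sigma_{ii}$ of size $n_i\times n_i$, $n_1+n_2=n$, and put $\widetilde\Sigma_{11}=\widehat\Sigma_{11}-\widehat\Sigma_{12}\widehat\Sigma_{22}^{-1}\widehat\Sigma_{21}$. Let $(\mathcal H_t,D_t)_{t\ge0}$ be generated by $$\mathcal H_{t+1}=\widehat\Sigma(\mathcal H_t+D_t)^{-1}\mathcal H_t\big(D_t+\widehat\Sigma(\mathcal H_t+D_t)^{-1}\mathcal H_t\big)^{-1}\widehat\Sigma,\qquad D_{t+1}=\Delta(\widehat\Sigma-\mathcal H_{t+1}),$$ started at $\mathcal H_0=H_0H_0^\top$, $H_0=\begin{pmatrix}H_1\\H_2\end{pmatrix}$ with $H_1\in\mathbb{R}^{n_1\times k}$ and $H_2\in\mathbb{R}^{n_2\times k}$ of full row rank, and $D_0=\begin{pmatrix}\widetilde D_0&0\\0&0\end{pmatrix}$ with $\widetilde D_0\in\mathbb{R}^{n_1\times n_1}$ diagonal, $\widetilde D_0>0$. Denote by $\mathcal H_t^{11}$ the upper left $n_1\times n_1$ block of $\mathcal H_t$, and put $\widetilde{\mathcal H}_t=\mathcal H_t^{11}-\widehat\Sigma_{12}\widehat\Sigma_{22}^{-1}\widehat\Sigma_{21}$ for $t\ge1$ and $\widetilde{\mathcal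 H}_0=H_1(I-H_2^\top(H_2H_2^\top)^{-1}H_2)H_1^\top$. Then the upper left block $\mathcal H^{11}_t$ can be computed by running the recursion $$\widetilde{\mathcal H}_{t+1}=\widetilde\Sigma_{11}(\widetilde{\mathcal H}_t+\widetilde D_t)^{-1}\widetilde{\mathcal H}_t\big(\widetilde D_t+\widetilde\Sigma_{11}(\widetilde{\mathcal H}_t+\widetilde D_t)^{-1}\widetilde{\mathcal H}_t\big)^{-1}\widetilde\Sigma_{11},\qquad t\ge0,$$ whereas the other blocks of $\mathcal H_t$ remain constant for $t\ge1$ (equal to $\widehat\Sigma_{12},\widehat\Sigma_{21},\widehat\Sigma_{22}$). The iterates $D_t$ all have zero lower right $n_2\times n_2$ block, i.e. $D_t=\begin{pmatrix}\widetilde D_t&0\\0&0\end{pmatrix}$, while the upper left $n_1\times n_1$ block satisfies, for $t\ge1$, $$\widetilde D_t=\Delta(\widetilde\Sigma_{11}-\widetilde{\mathcal H}_t).$$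
   Context: $k<n$, and necessarily $n_2\le k$. For a square matrix $M$, $\Delta(M)$ is the diagonal matrix with the same diagonal as $M$. *)

(* Defs.v *)
From HB Require Import structures.
From mathcomp Require Import all_boot all_order all_algebra.
From mathcomp Require Import reals.

Set Implicit Arguments.
Unset Strict Implicit.
Unset Printing Implicit Defensive.

Import Order.TTheory GRing.Theory Num.Theory.
Local Open Scope ring_scope.

Definition posdefmx (R : realType) (n : nat) (M : 'M[R]_n) : Prop :=
  M^T = M /\ forall x : 'cV[R]_n, x != 0 -> 0 < (x^T *m M *m x) 0 0.

Definition Delta (R : realType) (n : nat) (M : 'M[R]_n) : 'M[R]_n :=
  diag_mx (\row_i M i i).

Definition am_fact (R : realType) (n : nat) (Sigma H D : 'M[R]_n) : 'M[R]_n :=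
  Sigma *m invmx (H + D) *m H.

Definition am_step (R : realType) (n : nat) (Sigma H D : 'M[R]_n) : 'M[R]_n :=
  am_fact Sigma H D *m invmx (D + am_fact Sigma H D) *m Sigma.

(* invmx is total (invmx A = A when A is singular); this says that both
   inverses occurring in am_step Sigma H D are genuine. *)
Definition am_step_defined (R : realType) (n : nat) (Sigma H D : 'M[R]_n) : Prop :=
  H + D \in unitmx /\ D + am_fact Sigma H D \in unitmx.

Section Blocks.
Variables (R : realType) (n1 n2 : nat).

Definition regr_mx (Sigma : 'M[R]_(n1 + n2)) : 'M[R]_n1 :=
  ursubmx Sigma *m invmx (drsubmx Sigma) *m dlsubmx Sigma.

Definition Sigma11_tilde (Sigma : 'M[R]_(n1 + n2)) : 'M[R]_n1 :=
  ulsubmx Sigma - regr_mx Sigma.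

Definition Htilde (k : nat) (Sigma : 'M[R]_(n1 + n2))
    (H1 : 'M[R]_(n1, k)) (H2 : 'M[R]_(n2, k)) (H : nat -> 'M[R]_(n1 + n2))
    (t : nat) : 'M[R]_n1 :=
  if t is 0%N
  then H1 *m (1%:M - H2^T *m invmx (H2 *m H2^T) *m H2) *m H1^T
  else ulsubmx (H t) - regr_mx Sigma.

End Blocks.

(* Main.v *)
Require Import Defs.
From HB Require Import structures.
From mathcomp Require Import all_boot all_order all_algebra.
From mathcomp Require Import reals.

Import Order.TTheory GRing.Theory Num.Theory.
Local Open Scope ring_scope.

(** The reduction is a Schur complement computation.  Put
    [Y = Sigma12 Sigma22^-1] and [Z = Sigma22^-1 Sigma21]; then
    [Sigma = M diag(Sigma~, Sigma22) N] with [M] upper and [N] lower block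
    unitriangular, built from [Y] and [Z].  When [D = diag(D~, 0)] and the
    lower right block of [H] is invertible, [H + D] has the block factorization
    of [H] with its Schur complement [H~] replaced by [H~ + D~], because [D] is
    unchanged by multiplication by unitriangular factors of this shape.  Hence
    [(H + D)^-1 H] is block lower triangular with diagonal blocks
    [(H~ + D~)^-1 H~] and [1], and the step on [(Sigma, H, D)] evaluates to
    [M diag(H~', Sigma22) N], where [H~'] is the step on [(Sigma~, H~, D~)]
    ([am_step_block]).  So after one step all blocks but the upper left are
    those of [Sigma], the Schur complement has made one reduced step, and
    [Sigma - H'] is [Sigma~ - H~'] bordered by zeros, which yields the shape
    and the value of the next [D].

    Iterating this requires the reduced step to be genuinely defined at each
    time.  The invariant is that [H~] is positive semidefinite and [D~]
    positive definite.  It propagates because of two closed forms, with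
    [P = D (H + D)^-1 H] the parallel sum of [D] and [H], [W = D S^-1 D] and
    [E = W + P]: the step [H'] on [(S, H, D)] satisfies [S - H' = D E^-1 D],
    which is positive definite, and [H' = D E^-1 (P + P W^-1 P) E^-1 D], which
    is positive semidefinite ([am_step_posdef]).  In particular the diagonal of
    [S - H'] is positive.  At time [0] the Schur complement is
    [H1 Pi H1^T], where [Pi] is the orthogonal projection onto the kernel of
    [H2], so it is positive semidefinite. *)

(** * Positive definite and semidefinite matrices *)

Section Definiteness.
Set Implicit Arguments.
Unset Strict Implicit.
Variable R : realType.

Definition possemidefmx (n : nat) (M : 'M[R]_n) : Prop :=
  M^T = M /\ forall x : 'cV[R]_n, 0 <= (x^T *m M *m x) 0 0.

Lemma posdef_possemidef n (A : 'M[R]_n) : posdefmx A -> possemidefmx A.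
Proof.
case=> symA posA; split=> // x; have [->|/posA/ltW //] := eqVneq x 0.
by rewrite mulmx0 mxE.
Qed.

Lemma posdef_unit n (A : 'M[R]_n) : posdefmx A -> A \in unitmx.
Proof.
case=> symA posA; rewrite -row_free_unit; apply: inj_row_free => v vA0.
apply/eqP/negPn/negP => v0.
have /posA : v^T != 0 by apply: contraNneq v0 => /eqP; rewrite trmx_eq0.
by rewrite trmxK vA0 mul0mx mxE ltxx.
Qed.

Lemma possemidefD n (A B : 'M[R]_n) :
  possemidefmx A -> possemidefmx B -> possemidefmx (A + B).
Proof.
move=> [symA posA] [symB posB]; split; first by rewrite linearD /= symA symB.
by move=> x; rewrite mulmxDr mulmxDl mxE addr_ge0.
Qed.

Lemma posdefDr n (A B : 'M[R]_n) :
  posdefmx A -> possemidefmx B -> posdefmx (A + B).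
Proof.
move=> [symA posA] [symB posB]; split; first by rewrite linearD /= symA symB.
by move=> x x0; rewrite mulmxDr mulmxDl mxE ltr_pwDl ?posA.
Qed.

Lemma possemidef_congr m n (A : 'M[R]_m) (U : 'M[R]_(m, n)) :
  possemidefmx A -> possemidefmx (U^T *m A *m U).
Proof.
move=> [symA posA]; split; first by rewrite !trmx_mul trmxK symA mulmxA.
by move=> x; have := posA (U *m x); rewrite trmx_mul !mulmxA.
Qed.

(** A left inverse [V] of [U] expresses that [U] is injective. *)
Lemma posdef_congr m n (A : 'M[R]_m) (U : 'M[R]_(m, n)) (V : 'M[R]_(n, m)) :
  posdefmx A -> V *m U = 1%:M -> posdefmx (U^T *m A *m U).
Proof.
move=> [symA posA] VU; split; first by rewrite !trmx_mul trmxK symA mulmxA.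
move=> x x0; have := posA (U *m x); rewrite trmx_mul !mulmxA; apply.
by apply: contraNneq x0 => Ux0; rewrite -[x]mul1mx -VU -mulmxA Ux0 mulmx0.
Qed.

Lemma posdef1 n : posdefmx (1%:M : 'M[R]_n).
Proof.
split=> [|x x0]; first exact: trmx1.
rewrite mulmx1 mxE; under eq_bigr do rewrite mxE -expr2.
rewrite lt0r sumr_ge0 ?andbT => [|i _]; last exact: sqr_ge0.
apply: contra x0; rewrite psumr_eq0 => [/allP x0|i _]; last exact: sqr_ge0.
apply/eqP/matrixP => i j; rewrite ord1 mxE; apply/eqP.
by have := x0 i; rewrite mem_index_enum sqrf_eq0; apply.
Qed.

Lemma posdef_inv n (A : 'M[R]_n) : posdefmx A -> posdefmx (invmx A).
Proof.
move=> pA; have uA := posdef_unit pA; have [symA _] := pA.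
suff -> : invmx A = (invmx A)^T *m A *m invmx A.
  by apply: (@posdef_congr _ _ _ _ A) => //; exact: mulmxV.
by rewrite trmx_inv symA mulVmx // mul1mx.
Qed.

Lemma posdef_diag_gt0 n (A : 'M[R]_n) (i : 'I_n) : posdefmx A -> 0 < A i i.
Proof.
move=> [_ posA]; have := posA (delta_mx i 0).
rewrite trmx_delta -rowE -colE !mxE; apply.
by apply/eqP => /matrixP/(_ i 0)/eqP; rewrite !mxE !eqxx oner_eq0.
Qed.

Lemma posdef_diag_mx n (d : 'rV[R]_n) :
  (forall i, 0 < d 0 i) -> posdefmx (diag_mx d).
Proof.
move=> d_gt0; split=> [|x x0]; first exact: tr_diag_mx.
have [i xi0] : exists i, x i 0 != 0.
  by apply/existsP; apply: contraNT x0 => /existsPn x0;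
     apply/eqP/matrixP => i j; rewrite ord1 mxE; apply/eqP/negPn/x0.
have E j : (x^T *m diag_mx d) 0 j * x j 0 = d 0 j * x j 0 ^+ 2.
  by rewrite mul_mx_diag !mxE mulrAC mulrC -expr2.
rewrite mxE (bigD1 i) //= E ltr_pwDl //.
  by rewrite mulr_gt0 ?d_gt0 // lt0r sqrf_eq0 xi0 sqr_ge0.
by apply: sumr_ge0 => j _; rewrite E mulr_ge0 ?sqr_ge0 ?ltW.
Qed.

Lemma posdef_Delta n (A : 'M[R]_n) : posdefmx A -> posdefmx (Delta A).
Proof.
by move=> pA; apply: posdef_diag_mx => i; rewrite mxE posdef_diag_gt0.
Qed.

Lemma posdef_gram m n (A : 'M[R]_(m, n)) : row_free A -> posdefmx (A *m A^T).
Proof.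
move=> fA; have -> : A *m A^T = A^T^T *m 1%:M *m A^T by rewrite trmxK mulmx1.
apply: (@posdef_congr _ _ _ _ (pinvmx A)^T); first exact: posdef1.
by rewrite -trmx_mul mulmxVp // trmx1.
Qed.

(** The middle factor is the orthogonal projection onto the kernel of [H2],
    hence [Pi^T Pi], and the product is the Gram matrix of [Pi H1^T]. *)
Lemma possemidef_gram_proj n1 n2 k (H1 : 'M[R]_(n1, k)) (H2 : 'M[R]_(n2, k)) :
  row_free H2 ->
  possemidefmx (H1 *m (1%:M - H2^T *m invmx (H2 *m H2^T) *m H2) *m H1^T).
Proof.
move=> /posdef_gram pG; have uG := posdef_unit pG.
set Pi := 1%:M - _.
have PiT : Pi^T = Pi.
  by rewrite /Pi linearB /= trmx1 !trmx_mul trmx_inv trmx_mul !trmxK mulmxA.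
have PiPi : Pi *m Pi = Pi.
  rewrite {1}/Pi mulmxBl mul1mx -[RHS]subr0; congr (_ - _).
  rewrite /Pi mulmxBr mulmx1 !mulmxA -(mulmxA _ H2 H2^T).
  by rewrite -(mulmxA _ _ (H2 *m _)) mulVmx // mulmx1 subrr.
have -> : H1 *m Pi *m H1^T = (Pi *m H1^T)^T *m 1%:M *m (Pi *m H1^T).
  by rewrite mulmx1 trmx_mul trmxK PiT -!mulmxA (mulmxA Pi Pi) PiPi.
exact/possemidef_congr/posdef_possemidef/posdef1.
Qed.

(** * The step on a positive definite diagonal part *)

Lemma parallel_sumC n (H D : 'M[R]_n) : H + D \in unitmx ->
  D *m invmx (H + D) *m H = H *m invmx (H + D) *m D.
Proof.
move=> uHD; apply: (addrI (H *m invmx (H + D) *m H)).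
by rewrite -mulmxDr mulmxKV // -!mulmxDl mulmxV // mul1mx.
Qed.

(** Splitting [P = D Q H] along [1 = Q (H + D)] and using that [D Q H] is
    symmetric in [D] and [H] makes [P] a sum of two congruences. *)
Lemma possemidef_parallel_sum n (H D : 'M[R]_n) :
  possemidefmx H -> posdefmx D ->
  possemidefmx (D *m invmx (H + D) *m H).
Proof.
move=> pH pD; have pHD : posdefmx (H + D) by rewrite addrC; exact: posdefDr.
have uHD := posdef_unit pHD; have C := parallel_sumC uHD.
have [symH _] := pH; have [symD _] := pD.
have symQ : (invmx (H + D))^T = invmx (H + D).
  by rewrite trmx_inv linearD /= symH symD.
set Q := invmx _ in C symQ *.
have -> : D *m Q *m H = (Q *m D)^T *m H *m (Q *m D) + (Q *m H)^T *m D *m (Q *m H).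
  rewrite !trmx_mul symQ symH symD !mulmxA -C -!(mulmxA _ Q) -mulmxDr -mulmxDr.
  by rewrite [D + H]addrC mulVmx // mulmx1.
apply: possemidefD; apply: possemidef_congr => //; exact: posdef_possemidef.
Qed.

(** Writing [F = am_fact S H D] as [S D^-1 P], with [P] the parallel sum of [D]
    and [H], gives [D + F = S D^-1 E] for the positive definite
    [E = D S^-1 D + P]; this makes both inverses genuine and yields closed forms
    for the step and for its gap to [S].  Neither [H] nor [P] is
    inverted, since both may have low rank. *)
Lemma am_step_posdef n (S H D : 'M[R]_n) :
  posdefmx S -> possemidefmx H -> posdefmx D ->
  [/\ am_step_defined S H D, possemidefmx (am_step S H D) &
      posdefmx (S - am_step S H D)].
Proof.
move=> pS pH pD; have [symS _] := pS; have [symD _] := pD.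
have uS := posdef_unit pS; have uD := posdef_unit pD.
have uHD : H + D \in unitmx by apply: posdef_unit; rewrite addrC; exact: posdefDr.
have pP := possemidef_parallel_sum pH pD.
set P := D *m invmx (H + D) *m H in pP.
pose W := D *m invmx S *m D; pose E := W + P.
have pW : posdefmx W.
  rewrite /W -{1}symD; apply: (@posdef_congr _ _ _ _ (invmx D)).
    exact: posdef_inv.
  exact: mulVmx.
have uW := posdef_unit pW; have [symP _] := pP.
have pE : posdefmx E by exact: posdefDr.
have uE := posdef_unit pE; have [symE _] := pE.
have FE : am_fact S H D = S *m invmx D *m P.
  by rewrite /P /am_fact !mulmxA mulmxKV.
clearbody P.
have DFE : D + am_fact S H D = S *m invmx D *m E.
  rewrite FE /E mulmxDr; congr (_ + _).
  by rewrite /W !mulmxA mulmxKV // mulmxV // mul1mx.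
have uDF : D + am_fact S H D \in unitmx.
  by rewrite DFE !unitmx_mul unitmx_inv uS uD uE.
have FVE : am_fact S H D *m invmx (D + am_fact S H D) *m S =
    S *m invmx D *m P *m invmx E *m D.
  suff <- : invmx E *m D *m invmx S = invmx (D + am_fact S H D).
    by rewrite FE !mulmxA mulmxKV.
  have I : invmx E *m D *m invmx S *m (D + am_fact S H D) = 1%:M.
    by rewrite DFE !mulmxA mulmxKV // mulmxK // mulVmx.
  by rewrite -[LHS](mulmxK uDF) I mul1mx.
have pEV : (invmx E *m D)^T = D *m invmx E by rewrite trmx_mul trmx_inv symE symD.
(* [S D^-1 = D W^-1], and [W^-1 P] is symmetrized by the factor
   [E = W + P] inserted in front of it. *)
have HE : am_step S H D =
    (invmx E *m D)^T *m (P + P^T *m invmx W *m P) *m (invmx E *m D).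
  have -> : P + P^T *m invmx W *m P = E *m invmx W *m P.
    by rewrite /E !mulmxDl mulmxV // mul1mx symP.
  rewrite /am_step FVE pEV !mulmxA (mulmxKV uE); congr (_ *m _ *m _ *m _).
  have -> : S *m invmx D = S *m invmx D *m W *m invmx W by rewrite mulmxK.
  by rewrite /W !mulmxA mulmxKV // mulmxV // mul1mx.
have SHE : S - am_step S H D = D^T *m invmx E *m D.
  rewrite /am_step FVE symD.
  have {1}-> : S = S *m invmx D *m E *m invmx E *m D by rewrite mulmxK // mulmxKV.
  rewrite -!mulmxBl -mulmxBr /E addrK /W !mulmxA mulmxKV // mulmxV //.
  by rewrite mul1mx.
split=> //.
- rewrite HE; apply: possemidef_congr; apply: possemidefD => //.
  exact/possemidef_congr/posdef_possemidef/posdef_inv.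
- rewrite SHE; apply: (@posdef_congr _ _ _ _ (invmx D)); last exact: mulVmx.
  exact: posdef_inv.
Qed.

End Definiteness.

(** * Schur complements *)

(** [Sigma11_tilde M] is the Schur complement of the lower right block of an
    arbitrary block matrix [M]; it is used below for [H] as well as for
    [Sigma]. *)

Section Schur.
Variables (R : realType) (n1 n2 : nat).
Set Implicit Arguments.
Unset Strict Implicit.
Implicit Types (M Sigma H : 'M[R]_(n1 + n2)).

Lemma schur_factor M : drsubmx M \in unitmx ->
  M = block_mx 1%:M (ursubmx M *m invmx (drsubmx M)) 0 1%:M
      *m block_mx (Sigma11_tilde M) 0 0 (drsubmx M)
      *m block_mx 1%:M 0 (invmx (drsubmx M) *m dlsubmx M) 1%:M.
Proof.
move=> uM; rewrite !mulmx_block !(mul1mx, mulmx1, mul0mx, mulmx0, addr0, add0r).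
rewrite mulmxKV // mulKVmx // mulmxA /Sigma11_tilde subrK.
exact/esym/submxK.
Qed.

(** Both diagonal blocks of the factorization of a symmetric [Sigma] are
    congruences of it: by the inclusion of the last coordinates here, and by the
    first column of the inverse lower unitriangular factor below. *)
Lemma posdef_drsubmx Sigma : posdefmx Sigma -> posdefmx (drsubmx Sigma).
Proof.
move=> pS; pose U : 'M[R]_(n1 + n2, n2) := col_mx 0 1%:M.
have -> : drsubmx Sigma = U^T *m Sigma *m U.
  rewrite -{2}[Sigma]submxK /U tr_col_mx mul_row_block mul_row_col.
  by rewrite trmx0 trmx1 !(mul1mx, mulmx1, mul0mx, mulmx0, addr0, add0r).
apply: (@posdef_congr _ _ _ _ _ (row_mx 0 1%:M)) => //.
by rewrite mul_row_col mul0mx mul1mx add0r.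
Qed.

Lemma posdef_Sigma11_tilde Sigma :
  posdefmx Sigma -> posdefmx (Sigma11_tilde Sigma).
Proof.
move=> pS; have pd := posdef_drsubmx pS; have ud := posdef_unit pd.
have [symd _] := pd; have [symS _] := pS.
have trur : (ursubmx Sigma)^T = dlsubmx Sigma by rewrite trmx_ursub symS.
pose U := col_mx 1%:M (- (invmx (drsubmx Sigma) *m dlsubmx Sigma)).
have -> : Sigma11_tilde Sigma = U^T *m Sigma *m U.
  rewrite -{2}[Sigma]submxK /U tr_col_mx mul_row_block mul_row_col.
  rewrite trmx1 !mul1mx !mulmx1 linearN /= trmx_mul trmx_inv symd -trur trmxK.
  by rewrite !mulNmx (mulmxKV ud) subrr mul0mx addr0 trur.
apply: (@posdef_congr _ _ _ _ _ (row_mx 1%:M 0)) => //.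
by rewrite mul_row_col mul0mx mul1mx addr0.
Qed.

(** One step acts on the Schur complements alone.  The unitriangular
    factors of [H], built from [Y' = H12 H22^-1] and [X = H22^-1 H21], cancel:
    [Y'] in [(H + D)^-1 H], and [X], which only enters the lower left block of
    [F], in [F (D + F)^-1]. *)
Lemma am_step_block Sigma H (D : 'M[R]_n1) :
  drsubmx Sigma \in unitmx -> drsubmx H \in unitmx ->
  am_step_defined (Sigma11_tilde Sigma) (Sigma11_tilde H) D ->
  am_step Sigma H (block_mx D 0 0 0) =
  block_mx (am_step (Sigma11_tilde Sigma) (Sigma11_tilde H) D + regr_mx Sigma)
           (ursubmx Sigma) (dlsubmx Sigma) (drsubmx Sigma).
Proof.
move=> uS uH [uHD uE].
have simp := (mul1mx, mulmx1, mul0mx, mulmx0, addr0, add0r).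
have SE := schur_factor uS; have HE := schur_factor uH.
set St := Sigma11_tilde Sigma in uE SE *.
set Ht := Sigma11_tilde H in uHD uE HE *.
set S22 := drsubmx Sigma in uS SE *; set H22 := drsubmx H in uH HE.
set Y := ursubmx Sigma *m invmx S22 in SE.
set Z := invmx S22 *m dlsubmx Sigma in SE.
set X := invmx H22 *m dlsubmx H in HE.
set Y' := ursubmx H *m invmx H22 in HE.
set F := am_fact St Ht D in uE *.
pose G := invmx (Ht + D) *m Ht.
(* [K] is [diag(G, 1)] conjugated by the lower unitriangular factor of [H]. *)
pose K := block_mx G 0 (X - X *m G) 1%:M.
have HDE : H + block_mx D 0 0 0 =
    block_mx 1%:M Y' 0 1%:M *m block_mx (Ht + D) 0 0 H22
    *m block_mx 1%:M 0 X 1%:M.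
  by rewrite HE !mulmx_block add_block_mx !simp addrAC.
have uHDb : H + block_mx D 0 0 0 \in unitmx.
  rewrite HDE !unitmx_mul !unitmxE !(det_ublock, det_lblock) !det1 !mulr1.
  by rewrite !unitr1 unitrM -!unitmxE uHD uH.
have KE : invmx (H + block_mx D 0 0 0) *m H = K.
  suff {2}-> : H = (H + block_mx D 0 0 0) *m K by rewrite mulKmx.
  rewrite HDE {1}HE -!mulmxA; congr (_ *m _).
  rewrite /K !mulmx_block !simp subrKC.
  by rewrite /G /X !mulKVmx.
pose V := Z *m G + (X - X *m G).
have FE : am_fact Sigma H (block_mx D 0 0 0) =
    block_mx 1%:M Y 0 1%:M *m block_mx F 0 (S22 *m V) S22.
  rewrite /am_fact -mulmxA KE SE -!mulmxA; congr (_ *m _).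
  by rewrite /K /V !mulmx_block !simp /F /am_fact /G !mulmxA.
have stepE : am_step St Ht D = F *m invmx (D + F) *m St by [].
clearbody F.
have DFE : block_mx D 0 0 0 + am_fact Sigma H (block_mx D 0 0 0) =
    block_mx 1%:M Y 0 1%:M *m block_mx (D + F) 0 (S22 *m V) S22.
  by rewrite FE !mulmx_block add_block_mx !simp addrA.
have uDF : block_mx D 0 0 0 + am_fact Sigma H (block_mx D 0 0 0) \in unitmx.
  rewrite DFE !unitmx_mul !unitmxE !(det_ublock, det_lblock) !det1 !mulr1.
  by rewrite unitr1 unitrM -!unitmxE uE uS.
have VY : block_mx 1%:M (- Y) 0 1%:M *m block_mx 1%:M Y 0 1%:M
    = 1%:M :> 'M[R]_(n1 + n2).
  by rewrite mulmx_block !simp subrr -scalar_mx_block.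
(* [F (D + F)^-1] keeps no trace of the off-diagonal block [S22 V]: stripped of
   their common left factor, [F] and [D + F] have the same lower block row, so
   the quotient is block diagonal between unitriangular factors. *)
have JE : am_fact Sigma H (block_mx D 0 0 0)
      *m invmx (block_mx D 0 0 0 + am_fact Sigma H (block_mx D 0 0 0)) =
    block_mx 1%:M Y 0 1%:M *m block_mx (F *m invmx (D + F)) 0 0 1%:M
      *m block_mx 1%:M (- Y) 0 1%:M.
  set J := RHS.
  suff {1}-> : am_fact Sigma H (block_mx D 0 0 0) =
      J *m (block_mx D 0 0 0 + am_fact Sigma H (block_mx D 0 0 0)).
    by rewrite mulmxK.
  rewrite DFE FE /J -!mulmxA; congr (_ *m _).
  rewrite [block_mx 1%:M (- Y) _ _ *m _]mulmxA.
  by rewrite VY mul1mx mulmx_block !simp mulmxKV.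
rewrite stepE /am_step JE {1}SE -!mulmxA.
rewrite [block_mx 1%:M (- Y) _ _ *m _]mulmxA.
rewrite VY mul1mx !mulmx_block !simp.
by rewrite /regr_mx /Y /Z mulmxKV // mulKVmx // !mulmxA.
Qed.

Lemma Delta_block (A : 'M[R]_n1) (B : 'M[R]_(n1, n2)) (C : 'M[R]_(n2, n1))
    (D : 'M[R]_n2) :
  Delta (block_mx A B C D) = block_mx (Delta A) 0 0 (Delta D).
Proof.
rewrite /Delta -diag_mx_row; congr diag_mx; apply/rowP => i.
rewrite mxE; case: (split_ordP i) => j ->.
  by rewrite row_mxEl block_mxEul mxE.
by rewrite row_mxEr block_mxEdr mxE.
Qed.

End Schur.

(** * The reduced recursion *)

Theorem proposition7p10 (R : realType) (n1 n2 k : nat)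
  (k_lt_n : (k < n1 + n2)%N)
  (Sigma : 'M[R]_(n1 + n2)) (Sigma_posdef : posdefmx Sigma)
  (H1 : 'M[R]_(n1, k)) (H2 : 'M[R]_(n2, k)) (H2_full : row_free H2)
  (Dt0 : 'M[R]_n1) (Dt0_diag : is_diag_mx Dt0) (Dt0_posdef : posdefmx Dt0)
  (H D : nat -> 'M[R]_(n1 + n2))
  (H_init : H 0%N = col_mx H1 H2 *m (col_mx H1 H2)^T)
  (D_init : D 0%N = block_mx Dt0 0 0 0)
  (H_rec : forall t : nat, H t.+1 = am_step Sigma (H t) (D t))
  (D_rec : forall t : nat, D t.+1 = Delta (Sigma - H t.+1)) :
  let Ht := Htilde Sigma H1 H2 H in
  let Dt := fun t : nat => ulsubmx (D t) in
  [/\ forall t : nat,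
        am_step_defined (Sigma11_tilde Sigma) (Ht t) (Dt t) /\
        Ht t.+1 = am_step (Sigma11_tilde Sigma) (Ht t) (Dt t),
      forall t : nat, (0 < t)%N ->
        [/\ ursubmx (H t) = ursubmx Sigma,
            dlsubmx (H t) = dlsubmx Sigma &
            drsubmx (H t) = drsubmx Sigma],
      forall t : nat, D t = block_mx (Dt t) 0 0 0 &
      forall t : nat, (0 < t)%N -> Dt t = Delta (Sigma11_tilde Sigma - Ht t)].
Proof.
move=> Ht Dt.
have pSt := posdef_Sigma11_tilde Sigma_posdef.
have uS22 := posdef_unit (posdef_drsubmx Sigma_posdef).
(* The Schur complement of [H t] is [Ht t] uniformly in [t]: at [0] by the Gram
   form of [H 0], and later because the other blocks of [H t] are those of
   [Sigma]. *)
pose inv t := [/\ D t = block_mx (Dt t) 0 0 0, drsubmx (H t) \in unitmx,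
  Sigma11_tilde (H t) = Ht t, possemidefmx (Ht t) & posdefmx (Dt t)].
have inv0 : inv 0%N.
  have DtE : Dt 0%N = Dt0 by rewrite /Dt D_init block_mxKul.
  have H0E : H 0%N = block_mx (H1 *m H1^T) (H1 *m H2^T) (H2 *m H1^T) (H2 *m H2^T).
    by rewrite H_init tr_col_mx mul_col_row.
  split; rewrite ?DtE //.
  - by rewrite H0E block_mxKdr posdef_unit //; exact: posdef_gram.
  - rewrite H0E /Sigma11_tilde /regr_mx block_mxKul block_mxKur block_mxKdl.
    by rewrite block_mxKdr /Ht /= mulmxBr mulmx1 mulmxBl !mulmxA.
  - exact: possemidef_gram_proj.
have blockS t : inv t -> H t.+1 = block_mx
    (am_step (Sigma11_tilde Sigma) (Ht t) (Dt t) + regr_mx Sigma)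
    (ursubmx Sigma) (dlsubmx Sigma) (drsubmx Sigma).
  case=> DE uH HE pH pD; rewrite H_rec DE -HE am_step_block // HE.
  by have [] := am_step_posdef pSt pH pD.
have HtS t : inv t -> Ht t.+1 = am_step (Sigma11_tilde Sigma) (Ht t) (Dt t).
  by move/blockS => HE; rewrite {1}/Ht /= HE block_mxKul addrK.
have DS t : inv t ->
    D t.+1 = block_mx (Delta (Sigma11_tilde Sigma - Ht t.+1)) 0 0 0.
  move=> it; rewrite D_rec (blockS _ it) -(HtS _ it) -[X in X - _]submxK.
  rewrite opp_block_mx add_block_mx !subrr Delta_block.
  congr block_mx; last by apply/matrixP => i j; rewrite !mxE mul0rn.
  by rewrite /Sigma11_tilde opprD addrA addrAC.
have invS t : inv t -> inv t.+1.
  move=> it; have [DE uH HE pH pD] := it.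
  have [_ pH' pD'] := am_step_posdef pSt pH pD.
  have DtE : Dt t.+1 = Delta (Sigma11_tilde Sigma - Ht t.+1).
    by rewrite /Dt (DS _ it) block_mxKul.
  split.
  - by rewrite DtE; exact: DS.
  - by rewrite (blockS _ it) block_mxKdr.
  - rewrite (HtS _ it) [LHS]/Sigma11_tilde [regr_mx (H _)]/regr_mx (blockS _ it).
    by rewrite block_mxKul block_mxKur block_mxKdl block_mxKdr addrK.
  - by rewrite (HtS _ it).
  - by rewrite DtE (HtS _ it); exact: posdef_Delta.
have invT t : inv t by elim: t => [|t /invS].
split.
- move=> t; split; last exact: HtS.
  by have [_ _ _ pH pD] := invT t; have [] := am_step_posdef pSt pH pD.
- case=> // t _; rewrite (blockS _ (invT t)).
  by rewrite block_mxKur block_mxKdl block_mxKdr.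
- by move=> t; have [] := invT t.
- by case=> // t _; rewrite /Dt (DS _ (invT t)) block_mxKul.
Qed.
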